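(* The statement ''every shuffle compatible permutation statistic is a descent statistic'' is false; that is, there exists a permutation statistic that is shuffle compatible but is not a descent statistic.
   Context: A permutation $\sigma = \sigma_1\sigma_2\cdots\sigma_n$ of size $|\sigma| = n$ is a finite sequence of $n$ distinct integers (not necessarily $1,\dots,n$). $P_n$ denotes the set of permutations of size $n$, and $P = \bigcup_n P_n$. Two permutations $\sigma, \phi$ of the same size are equivalent, written $\sigma\sim\phi$, if they have the same relative order, i.e. for all $i,j$, $\sigma_i < \sigma_j$ if and only if $\phi_i < \phi_j$. A function $st$ on $P$ is a permutation statistic if $st(\sigma) = st(\phi)$ whenever $\sigma\sim\phi$. Two permutations are disjoint if they have no number in common. For disjoint permutations $\sigma,\phi$, a shuffle of $\sigma$ and $\phi$ is a permutation of size $|\sigma|+|\phi|$ that contains both $\sigma$ and $\phi$ as (not necessarily contiguous) subsequences; $\mathrm{Sh}(\sigma,\phi)$ denotes the set of all shuffles of $\sigma$ and $\phi$. A permutation statistic $st$ is shuffle compatible if for all disjoint permutations $\sigma,\phi$, the multiset $\{\{st(\gamma) \mid \gamma\in \mathrm{Sh}(\sigma,\phi)\}\}$ (one entry for each shuffle $\gamma$, counted with multiplicity) depends only on $st(\sigma)$, $st(\phi)$, $|\sigma|$ and $|\phi|$. That is, if $\sigma,\phi$ are disjoint, $\sigma',\phi'$ are disjoint, $|\sigma|=|\sigma'|$, $|\phi|=|\phi'|$, $st(\sigma)=st(\sigma')$ and $st(\phi)=st(\phi')$, then the two multisets coincide. The descent set of $\sigma\in P_n$ is $\mathrm{Des}(\sigma)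 = \{i \mid 1\le i<n,\ \sigma_i > \sigma_{i+1}\}$. A permutation statistic $st$ is a descent statistic if for every $n$ and all $\sigma,\phi\in P_n$, $\mathrm{Des}(\sigma)=\mathrm{Des}(\phi)$ implies $st(\sigma)=st(\phi)$. *)

(* Defs.v *)
From HB Require Import structures.
From mathcomp Require Import all_boot all_order all_algebra.

Set Implicit Arguments.
Unset Strict Implicit.
Unset Printing Implicit Defensive.

Import Order.TTheory GRing.Theory Num.Theory.

Record intperm := IntPerm { pval :> seq int; _ : uniq pval }.

HB.instance Definition _ := [isSub for pval].
HB.instance Definition _ := [Countable of intperm by <:].

Definition order_equiv (s t : intperm) : Prop :=
  size s = size t /\
  forall i j : nat, i < size s -> j < size s ->
    (nth 0 s i < nth 0 s j)%R = (nth 0 t i < nth 0 t j)%R.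

Definition permutation_statistic (T : Type) (st : intperm -> T) : Prop :=
  forall s t : intperm, order_equiv s t -> st s = st t.

Definition disjoint_perms (s t : intperm) : bool := ~~ has [in pval s] t.

Definition is_shuffle (s t u : intperm) : bool :=
  [&& size u == size s + size t, subseq s u & subseq t u].

(* For disjoint s and t this lists every shuffle exactly once: see
   [mem_shuffles] and [shuffles_uniq]. *)
Definition shuffles (s t : intperm) : seq intperm :=
  [seq u <- pmap insub (permutations (s ++ t)) | is_shuffle s t u].

Lemma shuffles_uniq (s t : intperm) : uniq (shuffles s t).
Proof. by rewrite filter_uniq // pmap_sub_uniq // permutations_uniq. Qed.

Lemma mem_shuffles (s t u : intperm) :
  disjoint_perms s t -> (u \in shuffles s t) = is_shuffle s t u.
Proof.
move=> dst; rewrite mem_filter; case: (boolP (is_shuffle s t u)) => //=.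
case/and3P=> /eqP szu su tu; rewrite mem_pmap_sub mem_permutations /=.
have ust : uniq (s ++ t) by rewrite cat_uniq; apply/and3P; split; [exact: (valP s) | exact: dst | exact: (valP t)].
have sub : {subset s ++ t <= pval u}.
  by move=> x; rewrite mem_cat => /orP[/(mem_subseq su) | /(mem_subseq tu)].
have [|_ eqm] := uniq_min_size ust sub; first by rewrite size_cat szu.
by rewrite perm_sym; apply: uniq_perm => //; exact: (valP u).
Qed.

(* Multisets of values are sequences up to [perm_eq]. *)
Definition shuffle_compatible (T : eqType) (st : intperm -> T) : Prop :=
  forall s t s' t' : intperm,
    disjoint_perms s t -> disjoint_perms s' t' ->
    size s = size s' -> size t = size t' ->
    st s = st s' -> st t = st t' ->
    perm_eq [seq st u | u <- shuffles s t] [seq st u | u <- shuffles s' t'].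

(* The increasing list of the descents, which are numbered from 1, whereas
   [nth] numbers the entries of s from 0. *)
Definition Des (s : intperm) : seq nat :=
  [seq i <- iota 1 (size s).-1 | (nth 0 s i < nth 0 s i.-1)%R].

Definition descent_statistic (T : Type) (st : intperm -> T) : Prop :=
  forall s t : intperm, size s = size t -> Des s = Des t -> st s = st t.

(* Main.v *)
Require Import Defs.
From mathcomp Require Import all_boot all_order all_algebra.

(** The counterexample is trivial except in size 4, where it takes two values.
    If [st] is constant on each size other than 4, the multiset of values over
    the shuffles of [s] and [t] is determined by the number of shuffles, hence
    by the two sizes, unless [size s + size t = 4].  When one of the two words
    is empty, the other is the only shuffle, and there is nothing to prove.  So
    [st] is shuffle compatible as soon as it takes each of its two values on
    exactly half of the shuffles of any two disjoint words of sizes 1 and 3, 2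
    and 2, or 3 and 1.

    This balance follows from antisymmetry.  Suppose that [st] changes value
    when the first two entries are exchanged, when the last two entries are
    exchanged, and when the first half of the word is exchanged with the second
    half.  The shuffles of [a] and [bcd] are then matched with opposite values:
    [abcd] with [bacd], and [bcad] with [bcda].  Those of [ab] and [cd] are
    matched likewise: [acbd] with [cabd], [acdb] with [cadb], and [abcd] with
    [cdab].  The case of sizes 3 and 1 mirrors the first one.

    The three exchanges generate a dihedral group of order 8, and the required
    signs define a character of it, so such functions exist and can be chosen
    independently on the three cosets of this group in the symmetric group.
    [block_parity] is one of them: it adds modulo 2 the indicators of a descent
    in position 1, of a descent in position 3, and of the second half having
    the larger maximum.  The last summand is not determined by the descent set:
    1324 and 1423 both have descent set {2}, but 4 is in the second half of the
    former and in the first half of the latter. *)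

Set Implicit Arguments.
Unset Strict Implicit.
Unset Printing Implicit Defensive.

Import Order.TTheory GRing.Theory Num.Theory.

(** * Enumerating shuffles recursively *)

Section Interleavings.

Variable T : eqType.
Implicit Types (x y : T) (s t u : seq T).

(** This recursive form serves two purposes: the number of shuffles is seen to
    depend on the two sizes alone, and in size 4 the list computes to explicit
    words, on which the statistic can be evaluated. *)
Fixpoint interleavings s t : seq (seq T) :=
  if s is x :: s' then
    (fix interleavings_s t :=
       if t is y :: t' then
         map (cons x) (interleavings s' t) ++ map (cons y) (interleavings_s t')
       else [:: s]) t
  else [:: t].

Lemma interleavings_cons x s y t :
  interleavings (x :: s) (y :: t) =
    map (cons x) (interleavings s (y :: t))
      ++ map (cons y) (interleavings (x :: s) t).
Proof. by []. Qed.

Lemma interleavingss0 s : interleavings s [::] = [:: s].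
Proof. by case: s. Qed.

Lemma mem_map_cons x y u (us : seq (seq T)) :
  (y :: u \in map (cons x) us) = (y == x) && (u \in us).
Proof.
apply/mapP/andP => [[v v_us [-> ->]] | [/eqP-> u_us]]; last by exists u.
by rewrite eqxx.
Qed.

Lemma size_interleavings_eq s t s' t' :
  size s = size s' -> size t = size t' ->
  size (interleavings s t) = size (interleavings s' t').
Proof.
elim: s t s' t' => [|x s IHs] t [|x' s'] t' //= [eq_s].
elim: t t' => [|y t IHt] [|y' t'] //= [eq_t].
rewrite !size_cat !size_map (IHt t') //; congr (_ + _).
by apply: IHs => //=; rewrite eq_t.
Qed.

(** An interleaving of words with no common letter is recovered letter by
    letter: its head is the head of exactly one of the two words. *)
Lemma interleavings_uniq s t : uniq (s ++ t) -> uniq (interleavings s t).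
Proof.
elim: s t => [|x s IHs] // t; elim: t => [|y t IHt] // ust.
have /andP[x_nin ust'] := ust.
rewrite interleavings_cons cat_uniq !map_inj_uniq; try by move=> ? ? [].
rewrite IHs // IHt; last first.
  by rewrite (subseq_uniq _ ust) // cat_subseq // subseq_cons.
rewrite andbT; apply/hasPn => _ /mapP[v _ ->].
rewrite mem_map_cons negb_and; apply/orP; left; apply: contra x_nin => /eqP<-.
by rewrite mem_cat mem_head orbT.
Qed.

Lemma mem_interleavings s t u :
  uniq (s ++ t) ->
  (u \in interleavings s t)
    = [&& size u == size s + size t, subseq s u & subseq t u].
Proof.
elim: s t u => [|x s IHs] t u.
  move=> _; rewrite mem_seq1 sub0seq /= add0n.
  apply/eqP/andP => [-> | [/eqP eq_sz t_u]]; first by rewrite eqxx subseq_refl.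
  by apply/esym/eqP; rewrite -(size_subseq_leqif t_u) eq_sz.
elim: t u => [|y t IHt] u ust.
  rewrite interleavingss0 mem_seq1 sub0seq addn0 andbT.
  apply/eqP/andP => [-> | [/eqP eq_sz s_u]]; first by rewrite eqxx subseq_refl.
  by apply/esym/eqP; rewrite -(size_subseq_leqif s_u) eq_sz.
have /andP[x_nin ust'] := ust.
have ust'' : uniq ((x :: s) ++ t).
  by rewrite (subseq_uniq _ ust) // cat_subseq // subseq_cons.
have neq_xy : x != y.
  by apply: contra x_nin => /eqP->; rewrite mem_cat mem_head orbT.
case: u => [|z u].
  by rewrite interleavings_cons mem_cat; apply/negP=> /orP[] /mapP[].
rewrite interleavings_cons mem_cat !mem_map_cons IHs // IHt //=.
rewrite !addSn !addnS !eqSS ![_ == z]eq_sym.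
have [-> | neq_zx] := eqVneq z x.
  by rewrite (negPf neq_xy) orbF.
have [_ | neq_zy] /= := eqVneq z y => //.
(* A word with head [z] other than [x] and [y] cannot contain both words as
   subsequences: its tail [u] would contain all their letters but is too short. *)
apply/esym/negP => /and3P[/eqP eq_sz s_u t_u].
suff : size ((x :: s) ++ y :: t) <= size u.
  by rewrite size_cat /= addSn addnS eq_sz ltnn.
apply: uniq_leq_size ust _ => w.
by rewrite mem_cat => /orP[/(mem_subseq s_u) | /(mem_subseq t_u)].
Qed.

End Interleavings.

Lemma uniq_cat_disjoint (s t : intperm) : disjoint_perms s t -> uniq (s ++ t).
Proof.
by move=> dst; rewrite cat_uniq (valP s) (valP t) andbT; exact: dst.
Qed.

Lemma perm_shuffles (s t : intperm) :
  disjoint_perms s t ->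
  perm_eq (map pval (shuffles s t)) (interleavings s t).
Proof.
move=> dst; have ust := uniq_cat_disjoint dst.
apply: uniq_perm; first by rewrite map_inj_uniq ?shuffles_uniq //; exact: val_inj.
  exact: interleavings_uniq.
move=> u; rewrite mem_interleavings //.
apply/mapP/idP => [[v] | u_sh]; first by rewrite mem_shuffles // => v_sh ->.
suff uu : uniq u by exists (IntPerm uu); rewrite ?mem_shuffles.
have /and3P[/eqP eq_sz s_u t_u] := u_sh.
have sub : {subset s ++ t <= u}.
  by move=> w; rewrite mem_cat => /orP[/(mem_subseq s_u) | /(mem_subseq t_u)].
by rewrite (leq_size_uniq ust sub) // size_cat eq_sz.
Qed.

(** * The statistic *)

Definition parity4 (a b c d : int) : bool :=
  (b < a)%O (+) (d < c)%O (+) (Order.max a b < Order.max c d)%O.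

Definition block_parity (u : seq int) : bool :=
  if u is [:: a; b; c; d] then parity4 a b c d else false.

Lemma parity4_swap12 a b c d : a != b -> parity4 b a c d = ~~ parity4 a b c d.
Proof.
move=> neq_ab; rewrite /parity4 (maxC b).
by rewrite [(b < a)%O]ltNge le_eqVlt (negPf neq_ab) !addNb negbK.
Qed.

Lemma parity4_swap34 a b c d : c != d -> parity4 a b d c = ~~ parity4 a b c d.
Proof.
move=> neq_cd; rewrite /parity4 (maxC d).
by rewrite [(d < c)%O]ltNge le_eqVlt (negPf neq_cd) addbN addNb negbK.
Qed.

Lemma parity4_swap_halves a b c d :
  uniq [:: a; b; c; d] -> parity4 c d a b = ~~ parity4 a b c d.
Proof.
rewrite /= !inE !negb_or => /and4P[/and3P[_ ac ad] /andP[bc bd] _ _].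
have neq_max : Order.max a b != Order.max c d by rewrite !maxEle; do 2 case: ifP.
rewrite /parity4 (addbC (d < c)%O).
by rewrite [(Order.max c d < _)%O]ltNge le_eqVlt (negPf neq_max) addbN.
Qed.

Lemma block_parity_size u : size u != 4 -> block_parity u = false.
Proof. by move: u => [|a [|b [|c [|d [|e u]]]]]. Qed.

Lemma block_parity_invariant : permutation_statistic (block_parity \o pval).
Proof.
move=> [s us] [t ut] [/= eq_sz eq_lt].
have [sz4 | sz_neq4] := eqVneq (size s) 4; last first.
  by rewrite !block_parity_size // -eq_sz.
move: s t {us ut} eq_sz eq_lt sz4.
move=> [|a [|b [|c [|d [|e s]]]]] // [|a' [|b' [|c' [|d' [|e' t]]]]] //=.
move=> _ eq_lt _; rewrite /parity4 !gt_max !lt_max.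
rewrite (eq_lt 1 0) // (eq_lt 3 2) // (eq_lt 0 2) // (eq_lt 0 3) //.
by rewrite (eq_lt 1 2) // (eq_lt 1 3).
Qed.

(** * Balance over the shuffles in size 4 *)

Lemma perm_bool_count (l1 l2 : seq bool) :
  size l1 = size l2 -> count id l1 = count id l2 -> perm_eq l1 l2.
Proof.
move=> eq_sz eq_ct; apply/allP => -[] _ /=; apply/eqP.
  by rewrite !(eq_count (a2 := id)) // => -[].
apply: (@addnI (count id l1)); rewrite {2}eq_ct.
by rewrite !(eq_count (a1 := pred1 false) (a2 := predC id)) ?count_predC // => -[].
Qed.

(** Every shuffle is matched with one of opposite parity, as antisymmetry under
    the three exchanges permits. *)
Lemma block_parity_balanced (s t : seq int) :
  uniq (s ++ t) -> size s + size t = 4 -> 0 < size s -> 0 < size t ->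
  (count block_parity (interleavings s t)).*2 = size (interleavings s t).
Proof.
move=> ust sz4 s_gt0 t_gt0.
have s_lt4 : size s < 4 by rewrite -sz4 -addn1 leq_add2l.
move: s t sz4 s_gt0 t_gt0 s_lt4 ust.
move=> [|a [|b [|c [|d s]]]] // [|a' [|b' [|c' [|d' t]]]] //= _ _ _ _ ust.
- move: ust; rewrite !inE !negb_or => /and4P[/and3P[aa' _ ac'] _ _ _].
  rewrite (parity4_swap12 _ _ aa') (parity4_swap34 _ _ ac').
  by case: (parity4 a a' _ _); case: (parity4 a' b' _ _).
- have halves := parity4_swap_halves ust.
  move: ust; rewrite !inE !negb_or => /and4P[/and3P[_ aa' _] _ _ _].
  rewrite !(parity4_swap12 _ _ aa') halves.
  by case: (parity4 a b _ _); case: (parity4 a a' b _);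
    case: (parity4 a a' b' _).
- move: ust; rewrite !inE !negb_or.
  move=> /and4P[/and3P[_ _ aa'] _ ca' _].
  rewrite (parity4_swap12 _ _ aa') (parity4_swap34 _ _ ca').
  by case: (parity4 a b _ _); case: (parity4 a a' _ _).
Qed.

Lemma count_block_parity0 (s t : seq int) :
  uniq (s ++ t) -> size s + size t != 4 ->
  count block_parity (interleavings s t) = 0.
Proof.
move=> ust sz_neq4; apply/eqP; rewrite -leqn0 leqNgt -has_count.
apply/hasPn => u; rewrite mem_interleavings // => /and3P[/eqP sz_u _ _].
by rewrite block_parity_size // sz_u.
Qed.

Lemma block_parity_shuffle_compatible :
  shuffle_compatible (block_parity \o pval).
Proof.
move=> s t s' t' dst dst' eq_s eq_t /= st_s st_t.
have [ust ust'] := (uniq_cat_disjoint dst, uniq_cat_disjoint dst').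
rewrite !(map_comp block_parity pval).
rewrite (perm_trans (perm_map _ (perm_shuffles dst))) // perm_sym.
rewrite (perm_trans (perm_map _ (perm_shuffles dst'))) // perm_sym.
have eq_size := size_interleavings_eq eq_s eq_t.
apply: perm_bool_count; rewrite ?size_map // !count_map.
rewrite !(eq_count (a1 := preim _ id) (a2 := block_parity)) //.
have [s0 | s_gt0] := posnP (size s).
  rewrite (size0nil s0) (size0nil (etrans (esym eq_s) s0)) /=.
  by rewrite st_t.
have [t0 | t_gt0] := posnP (size t).
  rewrite (size0nil t0) (size0nil (etrans (esym eq_t) t0)) !interleavingss0 /=.
  by rewrite st_s.
have [sz4 | sz_neq4] := eqVneq (size s + size t) 4; last first.
  by rewrite !count_block_parity0 // -eq_s -eq_t.
by apply: double_inj; rewrite !block_parity_balanced // -?eq_s -?eq_t.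
Qed.

Lemma block_parity_not_descent :
  ~ descent_statistic (block_parity \o pval).
Proof.
have uniq1324 : uniq [:: 1; 3; 2; 4]%Z by [].
have uniq1423 : uniq [:: 1; 4; 2; 3]%Z by [].
by move/(_ (IntPerm uniq1324) (IntPerm uniq1423) erefl erefl).
Qed.

Theorem corollary1p6 :
  exists (T : eqType) (st : intperm -> T),
    [/\ permutation_statistic st, shuffle_compatible st
      & ~ descent_statistic st].
Proof.
exists bool, (block_parity \o pval); split.
- exact: block_parity_invariant.
- exact: block_parity_shuffle_compatible.
- exact: block_parity_not_descent.
Qed.
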